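(* Let $D,N,R$ be positive integers with $N>1$, and suppose a $\mathrm{TFF}(D,N,R)$ is given. Then it can be obtained via iterated alternating Naimark and spatial complements from either: (i) a $\mathrm{TFF}(D_0,N,R_0)$ with $R_0\in\{\frac{D_0}N,D_0\}$, which is necessarily equi-isoclinic, or (ii) a $\mathrm{TFF}(D_0,N,R_0)$ where $(D_0,N,R_0)$ satisfies $0<\frac{2D_0}N\le R_0\le\frac{D_0}2$, depending on whether $f(D,N,R):=DNR-D^2-NR^2$ is negative or nonnegative, respectively. In either case, the triple $(D_0,N,R_0)$ is unique, and the given $\mathrm{TFF}(D,N,R)$ can only be equi-isoclinic if $R=R_0$ and $D\in\{D_0,NR_0-D_0\}$. Any such $\mathrm{TFF}(D_0,N,R_0)$ is real if and only if the given $\mathrm{TFF}(D,N,R)$ is real, and is equichordal if and only if the given $\mathrm{TFF}(D,N,R)$ is equichordal.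
   Context: Tight fusion frames. Let $D,N,R$ be positive integers with $N>1$. A $\mathrm{TFF}(D,N,R)$ is a sequence $\{\mathcal U_n\}_{n=1}^N$ of $R$-dimensional subspaces of a $D$-dimensional complex Hilbert space $\mathcal H$ whose orthogonal projections $\mathbf P_n$ satisfy $\sum_{n=1}^N\mathbf P_n=A\mathbf I$ for some $A>0$ (necessarily $A=\frac{NR}D\ge1$). It is real if there is a unitary $\mathbf U:\mathbb C^D\to\mathcal H$ such that every matrix $\mathbf U^*\mathbf P_n\mathbf U$ has all real entries. It is equichordal if $\operatorname{Tr}(\mathbf P_{n_1}\mathbf P_{n_2})$ is constant over all $n_1\neq n_2$, and equi-isoclinic if there exists $\lambda\ge0$ with $\mathbf P_{n_1}\mathbf P_{n_2}\mathbf P_{n_1}=\lambda\mathbf P_{n_1}$ for all $n_1\ne n_2$. Complements. If $D\ne R$, the spatial complement of a $\mathrm{TFF}(D,N,R)$ $\{\mathcal U_n\}$ is $\{\mathcal U_n^\perp\}$, which is a $\mathrm{TFF}(D,N,D-R)$. If $D\neq NR$, a Naimark complement of a $\mathrm{TFF}(D,N,R)$ $\{\mathcal U_n\}$ is defined as follows: choose isometries $\boldsymbol\Phi_n:\mathbb C^R\to\mathcal H$ with range $\mathcal U_n$; a Naimark complement is a sequence $\{\mathcal V_n\}_{n=1}^N$ of subspaces of an $(NR-D)$-dimensional Hilbert space $\mathcal K$ where $\mathcal V_n$ is the range of an isometry $\boldsymbol\Psi_n:\mathbb C^R\to\mathcal K$ and $\boldsymbol\Psi_{n_1}^*\boldsymbol\Psi_{n_2}=-\frac{D}{NR-D}\boldsymbol\Phi_{n_1}^*\boldsymbol\Phi_{n_2}$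 for all $n_1\ne n_2$. It exists, is unique up to unitaries, and is a $\mathrm{TFF}(NR-D,N,R)$. A $\mathrm{TFF}(D,N,R)$ with $D=R$ has no spatial complement and one with $D=NR$ has no Naimark complement. ''Obtained via iterated alternating Naimark and spatial complements'' means obtained (up to unitary equivalence) by a finite (possibly zero) number of successive complements, alternating between Naimark and spatial, beginning with either type. *)

(* Defs.v *)
From HB Require Import structures.
From mathcomp Require Import all_boot all_order all_algebra.

Set Implicit Arguments.
Unset Strict Implicit.
Unset Printing Implicit Defensive.

Import Order.TTheory GRing.Theory Num.Theory.
Local Open Scope ring_scope.
Local Open Scope sesquilinear_scope.

(* A D-dimensional Hilbert space is modelled as the row vectors 'rV[C]_D with
   the standard inner product (u *m v ^t* ) 0 0, and a subspace of it as the row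
   space of a matrix (as in mxalgebra), so that equality of subspaces is
   (_ == _)%MS and not Leibniz equality.  Operators act on row vectors on the
   right: matrix products compose from left to right, the adjoint of A is A^t*,
   and an isometry 'rV_R -> 'rV_D is a matrix 'M_(R, D) in unitarymx
   (A *m A^t* = 1), with range its row space. *)

Section FusionFrames.
Variable C : numClosedFieldType.

Definition subspaces (N D : nat) := 'I_N -> 'M[C]_D.

Definition is_TFF (N D : nat) (R : nat) (U : subspaces N D) : Prop :=
  [/\ [/\ (0 < D)%N, (1 < N)%N & (0 < R)%N],
      forall n, \rank (U n) = R
    & exists2 A : C, 0 < A & \sum_(n < N) proj_ortho (U n) = A%:M].

Definition is_real (N D : nat) (U : subspaces N D) : Prop :=
  exists2 Q : 'M[C]_D, Q \is unitarymx &
    forall n, Q *m proj_ortho (U n) *m Q^t* \is a mxOver Num.real.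

Definition equichordal (N D : nat) (U : subspaces N D) : Prop :=
  exists c : C, forall n1 n2, n1 != n2 ->
    \tr (proj_ortho (U n1) *m proj_ortho (U n2)) = c.

Definition equi_isoclinic (N D : nat) (U : subspaces N D) : Prop :=
  exists2 lambda : C, 0 <= lambda & forall n1 n2, n1 != n2 ->
    proj_ortho (U n1) *m proj_ortho (U n2) *m proj_ortho (U n1)
      = lambda *: proj_ortho (U n1).

Definition unitarily_equivalent (N D : nat) (U V : subspaces N D) : Prop :=
  exists2 Q : 'M[C]_D, Q \is unitarymx & forall n, (V n == U n *m Q)%MS.

Definition spatial_complement (N D : nat) (U : subspaces N D) :
    subspaces N D :=
  fun n => orthomx Num.conj (mx_of_hermitian (hermitian1mx _)) (U n).

Definition naimark_complement (N D D' R : nat)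
    (U : subspaces N D) (V : subspaces N D') : Prop :=
  exists (Phi : 'I_N -> 'M[C]_(R, D)) (Psi : 'I_N -> 'M[C]_(R, D')),
    [/\ forall n, Phi n \is unitarymx /\ (Phi n == U n)%MS,
        forall n, Psi n \is unitarymx /\ (Psi n == V n)%MS
      & forall n1 n2, n1 != n2 ->
          Psi n2 *m (Psi n1)^t* =
            - (D%:R / ((N * R)%:R - D%:R)) *: (Phi n2 *m (Phi n1)^t*)].

Inductive complement_type := Spatial | Naimark.

(* [alternating R0 U0 t R U]: U, with subspaces of dimension R, is reached from
   U0 by successive complements of alternating types, the last one being of
   type t (None if no complement was taken). *)
Inductive alternating (N D0 R0 : nat) (U0 : subspaces N D0) :
    option complement_type -> forall D : nat, nat -> subspaces N D -> Prop :=
| alternating_start : alternating R0 U0 None R0 U0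
| alternating_spatial t D R (U : subspaces N D) :
    alternating R0 U0 t R U -> t <> Some Spatial -> D <> R ->
    alternating R0 U0 (Some Spatial) (D - R)%N (spatial_complement U)
| alternating_naimark t D D' R (U : subspaces N D) (V : subspaces N D') :
    alternating R0 U0 t R U -> t <> Some Naimark -> D <> (N * R)%N ->
    D' = (N * R - D)%N -> naimark_complement R U V ->
    alternating R0 U0 (Some Naimark) R V.

Definition obtained_from (N D0 R0 D R : nat)
    (U0 : subspaces N D0) (U : subspaces N D) : Prop :=
  exists t (V : subspaces N D),
    alternating R0 U0 t R V /\ unitarily_equivalent V U.

End FusionFrames.

Definition fTFF (D N R : nat) : int :=
  D%:Z * N%:Z * R%:Z - D%:Z ^+ 2 - N%:Z * R%:Z ^+ 2.

Definition params_i (D0 N R0 : nat) : Prop :=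
  R0%:R = D0%:R / N%:R :> rat \/ R0 = D0.

Definition params_ii (D0 N R0 : nat) : Prop :=
  [/\ (0 : rat) < 2 * D0%:R / N%:R,
      2 * D0%:R / N%:R <= R0%:R :> rat
    & R0%:R <= D0%:R / 2 :> rat].

(* Main.v *)
(** The rows of the stacked isometries [Phi_n] of a tight fusion frame satisfy
    [X^t* *m X = A], so [A^-1 X X^t*] is a projection; factoring the complementary
    projection as [B^t* *m B] with [B] an isometry yields a Naimark complement,
    and a real Gram matrix has a real such factor, which is why realness passes
    to Naimark complements.

    Both complements preserve [fTFF] and [gcdn D R].  A spatial complement taken
    when [D < 2R] lowers [R], and a Naimark complement taken when [NR < 2D] lowers
    [D]; the two steps automatically alternate and stop in one of the two families.
    If [fTFF < 0] the final triple is recovered from [gcdn D R] and [fTFF].  If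
    [fTFF >= 0], a path leaving a fundamental triple has [D <= 2R] after each
    spatial step and [NR <= 2D] after each Naimark step, so it can be retraced
    uniquely.

    Equi-isoclinic subspaces are equal or intersect trivially, hence [D = R] or
    [2R <= D]; the same bound for the Naimark complement confines [D] to
    [2R <= D <= (N - 2)R] when [fTFF >= 0], where the path has not changed [R]. *)

Require Import Defs.
From HB Require Import structures.
From mathcomp Require Import all_boot all_order all_algebra.
From mathcomp Require Import reals complex.
From mathcomp Require Import zify ring lra.

Set Implicit Arguments.
Unset Strict Implicit.
Unset Printing Implicit Defensive.

Import Order.TTheory GRing.Theory Num.Theory.
Local Open Scope ring_scope.

(** * Adjoints and hermitian projections *)

Section Adjoint.
Local Open Scope sesquilinear_scope.
Variable C : numClosedFieldType.

Lemma adjM m n p (A : 'M[C]_(m, n)) (B : 'M[C]_(n, p)) :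
  (A *m B)^t* = B^t* *m A^t*.
Proof. by rewrite trmx_mul map_mxM. Qed.

Lemma adjB m n (A B : 'M[C]_(m, n)) : (A - B)^t* = A^t* - B^t*.
Proof. by rewrite linearB map_mxB. Qed.

Lemma adjZ m n a (A : 'M[C]_(m, n)) : (a *: A)^t* = a^* *: A^t*.
Proof. by rewrite linearZ map_mxZ. Qed.

Lemma adj0 m n : (0 : 'M[C]_(m, n))^t* = 0.
Proof. by rewrite trmx0 map_mx0. Qed.

Lemma adj_scalar n (a : C) : (a%:M : 'M[C]_n)^t* = a^*%:M.
Proof. by rewrite tr_scalar_mx map_scalar_mx. Qed.

Lemma adj_mxcol N (p : 'I_N -> nat) n (A : forall i, 'M[C]_(p i, n)) :
  (\mxcol_i A i)^t* = \mxrow_i (A i)^t*.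
Proof. by rewrite tr_mxcol; apply/matrixP => i j; rewrite !mxE. Qed.

Lemma realmx_adj m n (A : 'M[C]_(m, n)) : A \is a mxOver Num.real -> A^t* = A^T.
Proof. by move=> rA; rewrite -map_trmx realmxC. Qed.

Lemma realmx_tr m n (A : 'M[C]_(m, n)) :
  A \is a mxOver Num.real -> A^T \is a mxOver Num.real.
Proof. by move=> /mxOverP rA; apply/mxOverP => i j; rewrite mxE. Qed.

Lemma realmxB m n (A B : 'M[C]_(m, n)) : A \is a mxOver Num.real ->
  B \is a mxOver Num.real -> A - B \is a mxOver Num.real.
Proof.
move=> /mxOverP rA /mxOverP rB; apply/mxOverP => i j; rewrite !mxE.
exact: rpredB.
Qed.

Lemma mxtrace_mulmxtC m n (A : 'M[C]_(m, n)) :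
  \tr (A *m A^t*) = \sum_i \sum_j `|A i j| ^+ 2.
Proof.
by apply: eq_bigr => i _; rewrite mxE; apply: eq_bigr => j _; rewrite !mxE normCK.
Qed.

Lemma mxtrace_mulmxtC_ge0 m n (A : 'M[C]_(m, n)) : 0 <= \tr (A *m A^t*).
Proof.
rewrite mxtrace_mulmxtC; apply: sumr_ge0 => i _; apply: sumr_ge0 => j _.
by rewrite exprn_ge0.
Qed.

Lemma mxtrace_mulmxtC_eq0 m n (A : 'M[C]_(m, n)) :
  \tr (A *m A^t*) = 0 -> A = 0.
Proof.
rewrite mxtrace_mulmxtC => A0; apply/matrixP => i j; rewrite mxE.
have ge0 i' : 0 <= \sum_j `|A i' j| ^+ 2.
  by apply: sumr_ge0 => j' _; rewrite exprn_ge0.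
have := psumr_eq0P (fun i' _ => ge0 i') A0 (i := i) isT.
move/(psumr_eq0P (fun j' _ => exprn_ge0 2 (normr_ge0 (A i j'))))=> /(_ j isT).
by move/eqP; rewrite expf_eq0 /= normr_eq0 => /eqP.
Qed.

(* Induction on the rank: if [v] is a normalised nonzero row of [P], then
   [P - v^t* *m v] is a projection of smaller rank. *)
Lemma hermitian_idempotent_factor n (P : 'M[C]_n) :
    P^t* = P -> P *m P = P ->
  exists (r : nat) (B : 'M[C]_(r, n)),
    [/\ B \is unitarymx, B^t* *m B = P
      & P \is a mxOver Num.real -> B \is a mxOver Num.real].
Proof.
have [k] := ubnP (\rank P); elim: k P => // k IHk P leP hP iP.
have [->|P0] := eqVneq P 0.
  exists 0%N, 0; split=> [||_]; last exact: flatmxOver.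
    by apply/unitarymxP/matrixP => -[].
  by rewrite mulmx0.
have [i ui] : exists i, row i P != 0.
  apply/existsP; apply: contraNT P0; rewrite negb_exists => /forallP h.
  by apply/eqP/row_matrixP => i; rewrite row0; apply/eqP; move: (h i); rewrite negbK.
set u := row i P in ui; pose a := \tr (u *m u^t*).
have a_gt0 : 0 < a.
  rewrite lt_neqAle mxtrace_mulmxtC_ge0 andbT eq_sym.
  by apply: contraNneq ui => /mxtrace_mulmxtC_eq0 ->.
have uu : u *m u^t* = a%:M by rewrite [LHS]mx11_scalar -trace_mx11.
pose s := (sqrtC a)^-1.
have s_gt0 : 0 < s by rewrite invr_gt0 sqrtC_gt0.
have s_real : s \is Num.real by rewrite gtr0_real.
have ss : s * s * a = 1.
  by rewrite -expr2 exprVn sqrtCK mulVf ?gt_eqF.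
pose v := s *: u.
have vv : v *m v^t* = 1%:M.
  rewrite adjZ (CrealP s_real) -scalemxAl -scalemxAr scalerA uu.
  by rewrite scale_scalar_mx ss.
have uP : u *m P = u by rewrite /u -row_mul iP.
have vP : v *m P = v by rewrite -scalemxAl uP.
have Pv : P *m v^t* = v^t* by rewrite -{1}hP -adjM vP.
pose P' := P - v^t* *m v.
have hP' : P'^t* = P' by rewrite /P' adjB hP adjM trmxCK.
have vP' : v *m P' = 0 by rewrite mulmxBr mulmxA vv mul1mx vP subrr.
have P'v : P' *m v^t* = 0 by rewrite -{1}hP' -adjM vP' adj0.
have P'P : P' *m P = P' by rewrite mulmxBl iP -mulmxA vP.
have iP' : P' *m P' = P'.
  by rewrite {2}/P' mulmxBr P'P mulmxA P'v mul0mx subr0.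
have ltP : (\rank P' < k)%N.
  rewrite ltnS in leP; apply: leq_trans leP.
  rewrite ltn_neqAle; apply/andP; split; last first.
    by rewrite -P'P mxrankM_maxr.
  (* Equal ranks would put [v], which lies in the row space of [P], into that of [P']; then
     [v = v *m P' = 0], against [vv]. *)
  apply/eqP => eqr; have sub : (P <= P')%MS.
    have sP : (P' <= P)%MS by rewrite -P'P submxMl.
    by have [_ <-] := mxrank_leqif_sup sP; rewrite eqr.
  have : (v <= P')%MS by rewrite -vP (submx_trans (submxMl _ _)).
  case/submxP=> X vX; have v0 : v = 0 by rewrite vX -iP' mulmxA -vX vP'.
  move: vv; rewrite v0 mul0mx => /matrixP/(_ 0 0)/eqP.
  by rewrite !mxE eqxx eq_sym oner_eq0.
have [r [B [uB BB rB]]] := IHk P' ltP hP' iP'.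
have vB : v *m B^t* = 0.
  by rewrite -[LHS]mulmx1 -(unitarymxP uB) mulmxA -[v *m _ *m B]mulmxA BB vP' mul0mx.
exists (1 + r)%N, (col_mx v B); split.
- apply/unitarymxP; rewrite tr_col_mx map_row_mx mul_col_row vv vB (unitarymxP uB).
  by rewrite -[B *m v^t*]trmxCK adjM trmxCK vB adj0 -scalar_mx_block.
- by rewrite tr_col_mx map_row_mx mul_row_col BB addrC subrK.
move=> rP; have ru : v \is a mxOver Num.real.
  by rewrite mxOverZ //; apply/mxOverP => i1 j1; rewrite mxE (mxOverP rP).
have rP' : P' \is a mxOver Num.real.
  by rewrite realmxB // mxOverM // realmx_adj // realmx_tr.
apply/mxOverP => i1 j1; rewrite mxE; case: (split i1) => i2.
  exact: (mxOverP ru).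
exact: (mxOverP (rB rP')).
Qed.

End Adjoint.

(** * Orthogonal projections expressed through isometries *)

Section OrthogonalProjections.
Local Open Scope sesquilinear_scope.
Variable C : numClosedFieldType.

Lemma unitarymxCP n (Q : 'M[C]_n) : Q \is unitarymx -> Q^t* *m Q = 1%:M.
Proof. by rewrite -trmxC_unitary => /unitarymxP; rewrite trmxCK. Qed.

(** The rows of [E] lie in [U] and those of [1 - E] are orthogonal to [U], so the projection fixes
    the former and kills the latter. *)
Lemma proj_ortho_isometry m n p (U : 'M[C]_(m, n)) (Phi : 'M[C]_(p, n)) :
  Phi \is unitarymx -> (Phi == U)%MS -> proj_ortho U = Phi^t* *m Phi.
Proof.
move=> uPhi /eqmxP eqU; pose E := Phi^t* *m Phi.
have -> : proj_ortho U = E *m proj_ortho U + (1%:M - E) *m proj_ortho U.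
  by rewrite -mulmxDl addrC subrK mul1mx.
rewrite proj_ortho_id; last by rewrite -eqU submxMl.
rewrite proj_ortho_0 ?addr0 //; apply/orthomx1P.
have /submxP[X ->] : (U <= Phi)%MS by rewrite eqU.
by rewrite adjM mulmxA mulmxBl mul1mx mulmxtVK // subrr mul0mx.
Qed.

Lemma isometry_exists m n R (U : 'M[C]_(m, n)) : \rank U = R ->
  exists Phi : 'M[C]_(R, n), Phi \is unitarymx /\ (Phi == U)%MS.
Proof.
move=> <-; exists (schmidt (row_base U)); split.
  by rewrite schmidt_unitarymx ?rank_leq_col.
apply/eqmxP; apply: eqmx_trans (eq_row_base U).
exact/eqmx_schmidt_free/row_base_free.
Qed.

Lemma proj_ortho_eqmx m p n (U : 'M[C]_(m, n)) (V : 'M[C]_(p, n)) :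
  (U == V)%MS -> proj_ortho U = proj_ortho V.
Proof.
move=> UV; have [Phi [uPhi PhiU]] := isometry_exists (erefl (\rank U)).
rewrite (proj_ortho_isometry uPhi PhiU) (proj_ortho_isometry uPhi) //.
by apply/eqmxP; apply: eqmx_trans (eqmxP UV); apply/eqmxP.
Qed.

Lemma eqmx_proj_ortho m p n (U : 'M[C]_(m, n)) (V : 'M[C]_(p, n)) :
  proj_ortho U = proj_ortho V -> (U == V)%MS.
Proof.
move=> UV; apply/eqmxP; apply: eqmx_trans (proj_orthoE V).
by rewrite -UV; apply/eqmx_sym/proj_orthoE.
Qed.

Lemma proj_ortho_mulmx m n (U : 'M[C]_(m, n)) (Q : 'M[C]_n) :
  Q \is unitarymx -> proj_ortho (U *m Q) = Q^t* *m proj_ortho U *m Q.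
Proof.
move=> uQ; have [Phi [uPhi PhiU]] := isometry_exists (erefl (\rank U)).
rewrite (proj_ortho_isometry uPhi PhiU) (@proj_ortho_isometry _ _ _ _ (Phi *m Q)).
- by rewrite adjM !mulmxA.
- exact: mul_unitarymx.
- by apply/eqmxP/eqmxMr/eqmxP.
Qed.

Lemma proj_ortho_adj m n (U : 'M[C]_(m, n)) : (proj_ortho U)^t* = proj_ortho U.
Proof.
have [Phi [uPhi PhiU]] := isometry_exists (erefl (\rank U)).
by rewrite (proj_ortho_isometry uPhi PhiU) adjM trmxCK.
Qed.

Lemma mxtrace_proj_ortho m n (U : 'M[C]_(m, n)) :
  \tr (proj_ortho U) = (\rank U)%:R.
Proof.
have [Phi [uPhi PhiU]] := isometry_exists (erefl (\rank U)).
by rewrite (proj_ortho_isometry uPhi PhiU) mxtrace_mulC (unitarymxP uPhi) mxtrace1.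
Qed.

Lemma proj_spatial_complement N D (U : subspaces C N D) n :
  proj_ortho (spatial_complement U n) = 1%:M - proj_ortho (U n).
Proof.
by have := add_proj_ortho (U n) 1%:M; rewrite !mul1mx addrC => <-; rewrite addrK.
Qed.

End OrthogonalProjections.

(** * Tight fusion frames and spatial complements *)

Section TightFusionFrames.
Local Open Scope sesquilinear_scope.
Variable C : numClosedFieldType.
Variable N : nat.

Definition isometries_onto D R (Phi : 'I_N -> 'M[C]_(R, D))
    (U : subspaces C N D) :=
  forall n, Phi n \is unitarymx /\ (Phi n == U n)%MS.

Lemma isometries_exist D R (U : subspaces C N D) : is_TFF R U ->
  exists Phi : 'I_N -> 'M[C]_(R, D), isometries_onto Phi U.
Proof. by case=> _ rk _; exact: fin_all_exists (fun n => isometry_exists (rk n)). Qed.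

(** Taking traces identifies the frame constant: [A * D = N * R]. *)
Lemma TFF_sum D R (U : subspaces C N D) : is_TFF R U ->
  \sum_(n < N) proj_ortho (U n) = ((N * R)%:R / D%:R)%:M.
Proof.
case=> [[D_gt0 _ _] rk [A _ UA]]; rewrite UA; congr (_%:M).
have D0 : (D%:R : C) != 0 by rewrite pnatr_eq0 -lt0n.
have /eqP := congr1 mxtrace UA; rewrite mxtrace_scalar raddf_sum /=.
under eq_bigr => n _ do rewrite mxtrace_proj_ortho rk.
rewrite sumr_const card_ord -(mulr_natl R%:R) -natrM -(mulr_natr A) => /eqP ->.
by rewrite mulfK.
Qed.

(** The upper bound on [D] compares ranks: a nonzero multiple of the identity, of rank [D], is a sum
    of [N] projections of rank [R]. *)
Lemma TFF_bounds D R (U : subspaces C N D) : is_TFF R U ->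
  [/\ (0 < R)%N, (R <= D)%N & (D <= N * R)%N].
Proof.
move=> hU; have hs := TFF_sum hU; case: hU => [[D_gt0 N_gt1 R_gt0] rk _].
split=> //.
  by rewrite -(rk (Ordinal (ltnW N_gt1))) rank_leq_col.
have nz : ((N * R)%:R / D%:R : C) != 0.
  rewrite mulf_eq0 invr_eq0 !pnatr_eq0 !negb_or -!lt0n D_gt0 muln_gt0 R_gt0.
  by rewrite (ltnW N_gt1).
have <- : \rank (((N * R)%:R / D%:R)%:M : 'M[C]_D) = D.
  by rewrite -scalemx1 mxrank_scale_nz ?mxrank1.
rewrite -hs; apply: (@leq_trans (\sum_(n < N) \rank (proj_ortho (U n)))).
  elim/big_rec2: _ => [|n r P _ le]; first by rewrite mxrank0.
  by apply: leq_trans (mxrank_add _ _) _; rewrite leq_add2l.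
by rewrite (eq_bigr (fun=> R)) => [|n _]; rewrite ?sum_nat_const ?card_ord // proj_orthoE rk.
Qed.

Lemma TFF_spatial D R (U : subspaces C N D) : is_TFF R U -> D <> R ->
  is_TFF (D - R) (spatial_complement U).
Proof.
move=> hU /eqP DR; have [R_gt0 RD DNR] := TFF_bounds hU.
have hs := TFF_sum hU; case: (hU) => [[D_gt0 N_gt1 _] rk _].
have ltRD : (R < D)%N by rewrite ltn_neqAle eq_sym DR.
split; first by rewrite subn_gt0.
  by move=> n; rewrite rank_ortho rk.
(* The projections [1 - P_n] sum to [N - A] with [A = N * R / D], and [A < N] because [R < D]. *)
exists (N%:R - (N * R)%:R / D%:R).
  rewrite subr_gt0 ltr_pdivrMr ?ltr0n // -natrM ltr_nat ltn_pmul2l //.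
  exact: ltnW.
under eq_bigr => n _ do rewrite proj_spatial_complement.
rewrite sumrB hs sumr_const card_ord -scaler_nat scale_scalar_mx mulr1.
by rewrite raddfB.
Qed.

(** * Unitary equivalence, and properties kept by it and by spatial complements *)

Lemma equivalent_proj D (U V : subspaces C N D) (Q : 'M[C]_D) :
  Q \is unitarymx -> (forall n, (V n == U n *m Q)%MS) ->
  forall n, proj_ortho (V n) = Q^t* *m proj_ortho (U n) *m Q.
Proof. by move=> uQ VU n; rewrite (proj_ortho_eqmx (VU n)) proj_ortho_mulmx. Qed.

Lemma equivalent_eqmx D (U V : subspaces C N D) :
  (forall n, (V n == U n)%MS) -> unitarily_equivalent U V.
Proof.
move=> UV; exists 1%:M => [|n]; last by rewrite mulmx1.
by apply/unitarymxP; rewrite trmx1 map_mx1 mulmx1.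
Qed.

Lemma equivalent_refl D (U : subspaces C N D) : unitarily_equivalent U U.
Proof. by apply: equivalent_eqmx => n; apply/eqmxP. Qed.

Lemma equivalent_sym D (U V : subspaces C N D) :
  unitarily_equivalent U V -> unitarily_equivalent V U.
Proof.
case=> Q uQ VU; exists (Q^t*); first by rewrite trmxC_unitary.
move=> n; apply/eqmxP/eqmx_sym.
apply: eqmx_trans (eqmxMr _ (eqmxP (VU n))) _.
by rewrite mulmxtVK.
Qed.

Lemma equivalent_trans D (U V W : subspaces C N D) :
  unitarily_equivalent U V -> unitarily_equivalent V W -> unitarily_equivalent U W.
Proof.
case=> Q uQ VU [Q' uQ' WV]; exists (Q *m Q'); first exact: mul_unitarymx.
move=> n; apply/eqmxP; apply: eqmx_trans (eqmxP (WV n)) _.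
by rewrite mulmxA; apply/eqmxMr/eqmxP.
Qed.

Lemma is_real_equivalent D (U V : subspaces C N D) :
  unitarily_equivalent U V -> is_real U -> is_real V.
Proof.
case=> Q uQ VU [Z uZ rU]; exists (Z *m Q); first exact: mul_unitarymx.
move=> n; rewrite (equivalent_proj uQ VU) adjM.
by move: (proj_ortho _) (rU n) => P; rewrite !mulmxA mulmxtVK // mulmxtVK.
Qed.

Lemma equichordal_equivalent D (U V : subspaces C N D) :
  unitarily_equivalent U V -> equichordal U -> equichordal V.
Proof.
case=> Q uQ VU [c hc]; exists c => n1 n2 n12; rewrite -(hc _ _ n12).
rewrite !(equivalent_proj uQ VU).
move: (proj_ortho _) (proj_ortho _) => P1 P2.
by rewrite !mulmxA mulmxtVK // mxtrace_mulC !mulmxA (unitarymxP uQ) mul1mx.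
Qed.

Lemma equivalent_spatial D (U V : subspaces C N D) : unitarily_equivalent U V ->
  unitarily_equivalent (spatial_complement U) (spatial_complement V).
Proof.
case=> Q uQ VU; exists Q => // n; apply: eqmx_proj_ortho.
rewrite proj_ortho_mulmx // !proj_spatial_complement (equivalent_proj uQ VU).
by rewrite mulmxBr mulmxBl mulmx1 unitarymxCP.
Qed.

Lemma spatial_complementK D (U : subspaces C N D) :
  unitarily_equivalent (spatial_complement (spatial_complement U)) U.
Proof.
apply: equivalent_eqmx => n; apply: eqmx_proj_ortho.
by rewrite !proj_spatial_complement opprB addrC subrK.
Qed.

Lemma is_real_spatial D (U : subspaces C N D) :
  is_real U -> is_real (spatial_complement U).
Proof.
case=> Q uQ rU; exists Q => // n; rewrite proj_spatial_complement.
rewrite mulmxBr mulmxBl mulmx1 (unitarymxP uQ) realmxB //.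
by rewrite mxOver_scalar.
Qed.

Lemma equichordal_spatial D R (U : subspaces C N D) : is_TFF R U ->
  equichordal U -> equichordal (spatial_complement U).
Proof.
case=> _ rk _ [c hc]; exists (D%:R - R%:R - (R%:R - c)) => n1 n2 n12.
rewrite !proj_spatial_complement mulmxBl mulmxBr mulmx1 !mul1mx mulmxBr mulmx1.
by rewrite !raddfB /= hc // mxtrace1 !mxtrace_proj_ortho !rk.
Qed.

End TightFusionFrames.
(** * Naimark complements *)

Section NaimarkComplements.
Local Open Scope sesquilinear_scope.
Variables (C : numClosedFieldType) (N : nat).

(** The synthesis operator, acting on rows. Composing it with its adjoint in the two orders gives
    the frame operator and the Gram matrix. *)
Definition stack D R (Phi : 'I_N -> 'M[C]_(R, D)) : 'M[C]_(\sum_(n < N) R, D) :=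
  \mxcol_n Phi n.

Lemma stack_synthesis D R (Phi : 'I_N -> 'M[C]_(R, D)) :
  (stack Phi)^t* *m stack Phi = \sum_n (Phi n)^t* *m Phi n.
Proof. by rewrite /stack adj_mxcol mul_mxrow_mxcol. Qed.

Lemma stack_mul D D' R (Phi : 'I_N -> 'M[C]_(R, D)) (A : 'M_(D, D')) :
  stack Phi *m A = stack (fun n => Phi n *m A).
Proof. exact: mxcol_mul. Qed.

Lemma stack_gram D R (Phi : 'I_N -> 'M[C]_(R, D)) :
  stack Phi *m (stack Phi)^t* = \mxblock_(m, n) (Phi m *m (Phi n)^t*).
Proof. by rewrite /stack adj_mxcol mul_mxcol_mxrow. Qed.

Lemma submxblock_scalar R (c : C) (m n : 'I_N) :
  submxblock (c%:M : 'M[C]_(\sum_(i < N) R)) m n = ((m == n)%:R * c)%:M.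
Proof.
rewrite -(mxdiagZ (p_ := fun=> R)) mxblockK conform_mx_id.
by case: eqP => _; rewrite ?mul1r // mul0r raddf0.
Qed.

(** Turns the blockwise Gram relations, diagonal included, into one matrix identity. One direction
    serves to study a given Naimark complement, the other to construct one. *)
Lemma stack_gramP D D' R (Phi : 'I_N -> 'M[C]_(R, D)) (Psi : 'I_N -> 'M[C]_(R, D')) c k :
  (forall m n, Psi m *m (Psi n)^t* =
     ((m == n)%:R * c)%:M - k *: (Phi m *m (Phi n)^t*)) <->
  stack Psi *m (stack Psi)^t* = c%:M - k *: (stack Phi *m (stack Phi)^t*).
Proof.
have submxblockZ (M : 'M[C]_(\sum_(n < N) R)) (m n : 'I_N) :
    submxblock (k *: M) m n = k *: submxblock M m n.
  by apply/matrixP => i j; rewrite !mxE.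
rewrite !stack_gram -mxblockP; split=> h m n; move: (h m n);
  by rewrite submxblockB submxblock_scalar submxblockZ !mxblockK.
Qed.

Lemma isometry_gram D R (Phi : 'I_N -> 'M[C]_(R, D)) U m :
  isometries_onto Phi U -> Phi m *m (Phi m)^t* = 1%:M.
Proof. by move=> iPhi; apply/unitarymxP; case: (iPhi m). Qed.

Lemma isometry_proj D R (Phi : 'I_N -> 'M[C]_(R, D)) U n :
  isometries_onto Phi U -> proj_ortho (U n) = (Phi n)^t* *m Phi n.
Proof. by move=> iPhi; have [] := iPhi n; apply: proj_ortho_isometry. Qed.

Lemma TFF_stack D R (U : subspaces C N D) (Phi : 'I_N -> 'M[C]_(R, D)) :
  is_TFF R U -> isometries_onto Phi U ->
  (stack Phi)^t* *m stack Phi = ((N * R)%:R / D%:R)%:M.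
Proof.
move=> hU iPhi; rewrite stack_synthesis -(TFF_sum hU).
by apply: eq_bigr => n _; rewrite (isometry_proj n iPhi).
Qed.

Lemma stack_TFF D R (U : subspaces C N D) (Phi : 'I_N -> 'M[C]_(R, D)) (A : C) :
    (0 < D)%N -> (1 < N)%N -> (0 < R)%N -> isometries_onto Phi U ->
    0 < A -> (stack Phi)^t* *m stack Phi = A%:M ->
  is_TFF R U.
Proof.
move=> D0 N1 R0 iPhi A0 XA; split=> // [n|].
  by have [uPhi /eqmxP <-] := iPhi n; rewrite mxrank_unitary.
exists A => //; rewrite -XA stack_synthesis.
by apply: eq_bigr => n _; rewrite (isometry_proj n iPhi).
Qed.

Lemma isometry_change D R (Phi Phi' : 'M[C]_(R, D)) :
    Phi \is unitarymx -> Phi' \is unitarymx -> (Phi == Phi')%MS ->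
  exists2 W : 'M[C]_R, W \is unitarymx & Phi' = W *m Phi.
Proof.
move=> uPhi uPhi' /eqmxP e.
have /submxP[W eW] : (Phi' <= Phi)%MS by rewrite e.
exists W => //; apply/unitarymxP.
by rewrite -(unitarymxP uPhi') eW adjM mulmxA mulmxtVK.
Qed.

Definition naimark_ratio D R : C := D%:R / ((N * R)%:R - D%:R).

(** The isometries on the first side can be prescribed: they differ from those of the definition by
    unitaries [W n], and applying the same [W n] on the second side keeps the ranges and the cross
    relations. *)
Lemma naimark_isometries D D' R (U : subspaces C N D) (V : subspaces C N D')
    (Phi : 'I_N -> 'M[C]_(R, D)) :
    naimark_complement R U V -> isometries_onto Phi U ->
  exists2 Psi : 'I_N -> 'M[C]_(R, D'), isometries_onto Psi V &
    forall n1 n2, n1 != n2 ->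
      Psi n2 *m (Psi n1)^t* = - naimark_ratio D R *: (Phi n2 *m (Phi n1)^t*).
Proof.
move=> [Phi' [Psi' [iPhi' iPsi' cross]]] iPhi.
have /fin_all_exists2[W uW eW] n : exists2 W : 'M[C]_R, W \is unitarymx & Phi n = W *m Phi' n.
  have [uPhi /eqmxP ePhi] := iPhi n; have [uPhi' /eqmxP ePhi'] := iPhi' n.
  apply: isometry_change => //; apply/eqmxP; apply: eqmx_trans ePhi' _.
  exact: eqmx_sym.
exists (fun n => W n *m Psi' n) => [n|n1 n2 n12].
  have [uPsi' /eqmxP ePsi'] := iPsi' n; split; first exact: mul_unitarymx.
  apply/eqmxP; apply: eqmx_trans ePsi'.
  by apply: eqmxMfull; rewrite row_full_unit unitarymx_unit.
rewrite !eW !adjM !mulmxA -[_ *m _ *m (Psi' n1)^t*]mulmxA cross //.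
by rewrite -scalemxAr -!scalemxAl !mulmxA.
Qed.

Lemma naimark_equivalent D D' R (U V : subspaces C N D) (W : subspaces C N D') :
  unitarily_equivalent U V -> naimark_complement R U W -> naimark_complement R V W.
Proof.
case=> Q uQ VU [Phi [Psi [iPhi iPsi cross]]].
exists (fun n => Phi n *m Q), Psi; split=> // [n|n1 n2 n12].
  have [uPhi /eqmxP ePhi] := iPhi n; split; first exact: mul_unitarymx.
  apply/eqmxP/eqmx_sym; apply: eqmx_trans (eqmxP (VU n)) _.
  exact/eqmxMr/eqmx_sym.
by rewrite cross // adjM mulmxA mulmxtVK.
Qed.

(** In the coordinates given by [Q] each projection is real, hence factors through a real isometry
    [B n]; returning to [B n *m Q] leaves the Gram blocks unchanged, as [Q] is unitary. *)
Lemma real_isometries D R (U : subspaces C N D) : is_TFF R U -> is_real U ->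
  exists2 Phi : 'I_N -> 'M[C]_(R, D), isometries_onto Phi U &
    forall m n, Phi m *m (Phi n)^t* \is a mxOver Num.real.
Proof.
move=> [_ rk _] [Q uQ rU].
have /fin_all_exists2[B uB hB] n : exists2 B : 'M[C]_(R, D),
    B \is unitarymx /\ B \is a mxOver Num.real &
    B^t* *m B = Q *m proj_ortho (U n) *m Q^t*.
  have hP := proj_ortho_adj (U n); have iP := proj_ortho_proj (U n).
  have trP := mxtrace_proj_ortho (U n).
  move: (proj_ortho _) hP iP trP (rU n) => P hP iP trP rP.
  have [||r [B [uB BB rB]]] := @hermitian_idempotent_factor _ _ (Q *m P *m Q^t*).
  - by rewrite !adjM trmxCK hP mulmxA.
  - by rewrite !mulmxA mulmxKtV // -[Q *m P *m P]mulmxA iP.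
  have er : r = R.
    apply/eqP; rewrite -(eqr_nat C) -(rk n) -trP -(mxtrace1 C r) -(unitarymxP uB).
    by rewrite mxtrace_mulC BB mxtrace_mulC mulmxA unitarymxCP // mul1mx.
  by rewrite -er; exists B => //; split=> //; apply: rB.
exists (fun n => B n *m Q) => [n|m n].
  have uBQ : B n *m Q \is unitarymx by apply: mul_unitarymx => //; case: (uB n).
  split=> //; apply: eqmx_proj_ortho.
  rewrite (proj_ortho_isometry uBQ) ?adjM; last by apply/eqmxP.
  rewrite -mulmxA [(B n)^t* *m _]mulmxA hB; move: (proj_ortho _) => P.
  by rewrite !mulmxA unitarymxCP // mul1mx -mulmxA unitarymxCP // mulmx1.
rewrite adjM mulmxA mulmxtVK //; have [_ rm] := uB m; have [_ rn] := uB n.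
by rewrite mxOverM // realmx_adj // realmx_tr.
Qed.

(* The columns of [B^t*] are an orthonormal basis of the range of the real
   projection [A^-1 *: X *m X^t*]; in the coordinates given by the unitary
   [Q] each row of the stack [X] becomes real. *)
Lemma is_real_gram D R (U : subspaces C N D) (Phi : 'I_N -> 'M[C]_(R, D)) :
    is_TFF R U -> isometries_onto Phi U ->
    (forall m n, Phi m *m (Phi n)^t* \is a mxOver Num.real) ->
  is_real U.
Proof.
move=> hU iPhi rG; have XA := TFF_stack hU iPhi.
have [R_gt0 _ leDNR] := TFF_bounds hU; have [[D_gt0 N_gt1 _] _ _] := hU.
set A : C := _ / _ in XA; set X := stack Phi in XA.
have A_gt0 : 0 < A by rewrite divr_gt0 // ltr0n // (leq_trans _ leDNR).
have A_neq0 : A != 0 by rewrite gt_eqF.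
have rA : A^-1 \is Num.real by rewrite gtr0_real // invr_gt0.
pose s := sqrtC A; have ss : s * s = A by rewrite -expr2 sqrtCK.
have s_gt0 : 0 < s by rewrite sqrtC_gt0.
have s_real : s \is Num.real by rewrite gtr0_real.
pose E := A^-1 *: (X *m X^t*).
have rE : E \is a mxOver Num.real.
  rewrite mxOverZ // /X stack_gram; apply/mxOverP => i j.
  by rewrite mxE (mxOverP (rG _ _)).
have [B [uB rB] BB] : exists2 B : 'M[C]_(D, _),
    B \is unitarymx /\ B \is a mxOver Num.real & B^t* *m B = E.
  have [||r [B [uB BB rB]]] := @hermitian_idempotent_factor _ _ E.
  - by rewrite adjZ adjM trmxCK (CrealP rA).
  - rewrite -scalemxAl -scalemxAr mulmxA -[X *m _ *m X]mulmxA XA mul_mx_scalar.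
    by rewrite -scalemxAl [A^-1 *: (A *: _)]scalerA mulVf // scale1r.
  have er : r = D.
    apply/eqP; rewrite -(eqr_nat C) -(mxtrace1 C r) -(unitarymxP uB).
    rewrite mxtrace_mulC BB mxtraceZ mxtrace_mulC XA mxtrace_scalar.
    by rewrite mulrnAr mulVf.
  by rewrite -er; exists B => //; split=> //; apply: rB.
have XX : X *m X^t* = A *: (B^t* *m B) by rewrite BB scalerA mulfV // scale1r.
(* The Gram matrix of the rows of [B *m X] is [A] times the identity, whence the factor [s^-1], the
   inverse square root of [A]. *)
pose Q := s^-1 *: (B *m X).
have rs : s^-1 \is Num.real by rewrite rpredV.
have sA : s^-1 * A = s by rewrite -ss mulKf // gt_eqF.
have XQ : X *m Q^t* = s *: B^t*.
  rewrite adjZ (CrealP rs) adjM -scalemxAr mulmxA XX -scalemxAl.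
  by rewrite -mulmxA (unitarymxP uB) mulmx1 scalerA sA.
have uQ : Q \is unitarymx.
  apply/unitarymxP; rewrite -scalemxAl -mulmxA XQ -scalemxAr (unitarymxP uB).
  by rewrite scalerA mulVf ?scale1r // gt_eqF.
have rPQ n : Phi n *m Q^t* \is a mxOver Num.real.
  have -> : Phi n *m Q^t* = submxcol (p_ := fun=> R) (s *: B^t*) n.
    by rewrite -XQ /X stack_mul mxcolK.
  apply/mxOverP => i j; rewrite mxE realmx_adj // mxE mxE.
  by rewrite realM // (mxOverP rB).
exists Q => // n; rewrite (isometry_proj n iPhi).
have -> : Q *m ((Phi n)^t* *m Phi n) *m Q^t* = (Phi n *m Q^t*)^t* *m (Phi n *m Q^t*).
  by rewrite adjM trmxCK !mulmxA.
by rewrite mxOverM // realmx_adj // realmx_tr.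
Qed.

(** * The two members of a Naimark pair *)

Section Pair.
Variables (D D' R : nat) (U : subspaces C N D) (V : subspaces C N D').
Hypotheses (hU : is_TFF R U) (DNR : D <> (N * R)%N) (eD' : D' = (N * R - D)%N).

Let k := naimark_ratio D R.
Let A : C := (N * R)%:R / D%:R.

Lemma naimark_ltn : (D < N * R)%N.
Proof. by have [_ _] := TFF_bounds hU; rewrite leq_eqVlt => /orP[/eqP|]. Qed.

Lemma naimark_gtn0 : (0 < D)%N.
Proof. by case: hU => [[]]. Qed.

Let D0 : D%:R != 0 :> C.
Proof. by rewrite pnatr_eq0 -lt0n naimark_gtn0. Qed.

Let natrD' : D'%:R = (N * R)%:R - D%:R :> C.
Proof. by rewrite eD' natrB // ltnW // naimark_ltn. Qed.

Let D'_gt0 : (0 < D')%N.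
Proof. by rewrite eD' subn_gt0 naimark_ltn. Qed.

Let D'0 : (N * R)%:R - D%:R != 0 :> C.
Proof. by rewrite -natrD' pnatr_eq0 -lt0n. Qed.

Let k_gt0 : 0 < k.
Proof. by rewrite /k /naimark_ratio -natrD' divr_gt0 // ltr0n // naimark_gtn0. Qed.

(** This relation makes [(1 + k) - k X X^*] a multiple of a projection, since [X X^*] squares to [A]
    times itself. *)
Let kA : k * A = 1 + k.
Proof. by rewrite /k /A /naimark_ratio; field; rewrite D0 -natrM D'0. Qed.

Let A_gt0 : 0 < A.
Proof.
by rewrite divr_gt0 // ltr0n ?naimark_gtn0 // (leq_ltn_trans _ naimark_ltn).
Qed.

(** The constant [1 + k] is forced by the diagonal blocks, where both Gram matrices have the
    identity. *)
Lemma naimark_stack (Phi : 'I_N -> 'M[C]_(R, D)) (Psi : 'I_N -> 'M[C]_(R, D')) :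
    isometries_onto Phi U -> isometries_onto Psi V ->
    (forall n1 n2, n1 != n2 ->
      Psi n2 *m (Psi n1)^t* = - k *: (Phi n2 *m (Phi n1)^t*)) ->
  stack Psi *m (stack Psi)^t* = (1 + k)%:M - k *: (stack Phi *m (stack Phi)^t*).
Proof.
move=> iPhi iPsi cross; apply/stack_gramP => m n.
have [->|mn] := eqVneq m n; last first.
  by rewrite cross 1?eq_sym // mul0r raddf0 sub0r scaleNr.
rewrite (isometry_gram n iPhi) (isometry_gram n iPsi) mul1r scale_scalar_mx.
by rewrite mulr1 -raddfB addrK.
Qed.

(** The Gram matrix [Y Y^*] squares to [1 + k] times itself; a left inverse of [Y] cancels the outer
    factors and leaves [Y^* Y = 1 + k]. *)
Lemma TFF_naimark : naimark_complement R U V -> is_TFF R V.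
Proof.
case=> Phi [Psi [iPhi iPsi cross]]; have XA := TFF_stack hU iPhi.
have YY := naimark_stack iPhi iPsi cross.
case: (hU) => [[_ N_gt1 R_gt0] _ _].
apply: (@stack_TFF _ _ _ Psi (1 + k)) => //; first by rewrite addr_gt0.
set X := stack Phi in XA YY; set Y := stack Psi in YY *.
(* Writing [(1 + k)] times the identity as [k X X^* + Y Y^*] gives [N * R <= D + \rank Y], so [Y]
   has full column rank [D']. *)
have rkY : row_full Y.
  rewrite -col_leq_rank; apply: (@leq_trans (N * R - D)); first by rewrite -eD'.
  rewrite leq_subLR.
  have <- : \rank ((1 + k)%:M : 'M[C]_(\sum_(n < N) R)) = (N * R)%N.
    rewrite -scalemx1 mxrank_scale_nz ?mxrank1 ?sum_nat_const ?card_ord //.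
    by rewrite gt_eqF // addr_gt0.
  have -> : (1 + k)%:M = k *: (X *m X^t*) + Y *m Y^t* by rewrite YY [RHS]addrC subrK.
  apply: leq_trans (mxrank_add _ _) _; apply: leq_add.
    rewrite scalemxAl; apply: leq_trans (mxrankM_maxl _ _) _; exact: rank_leq_col.
  exact: mxrankM_maxl.
have [Z ZY] := row_fullP rkY.
have ZY' : Y^t* *m Z^t* = 1%:M by rewrite -adjM ZY adj_scalar rmorph1.
have YYYY : (Y *m Y^t*) *m (Y *m Y^t*) = (1 + k) *: (Y *m Y^t*).
  have XXXX : (X *m X^t*) *m (X *m X^t*) = A *: (X *m X^t*).
    by rewrite mulmxA -[X *m _ *m X]mulmxA XA mul_mx_scalar -scalemxAl.
  rewrite {1}YY mulmxBl mul_scalar_mx -scalemxAl YY mulmxBr mul_mx_scalar.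
  by rewrite -scalemxAr XXXX scalerA kA subrr scaler0 subr0.
have : Z *m ((Y *m Y^t*) *m (Y *m Y^t*)) *m Z^t* = Z *m ((1 + k) *: (Y *m Y^t*)) *m Z^t*.
  by rewrite YYYY.
rewrite -scalemxAr -scalemxAl !mulmxA ZY !mul1mx -!mulmxA ZY' !mulmx1.
by rewrite scalemx1.
Qed.

(** Exchanging the two sides inverts the ratio: [D' / (N * R - D') = (N * R - D) / D]. *)
Lemma naimark_sym : naimark_complement R U V -> naimark_complement R V U.
Proof.
case=> Phi [Psi [iPhi iPsi cross]]; exists Psi, Phi; split=> // n1 n2 n12.
rewrite cross // scalerA natrD' mulrNN.
have -> : (N * R)%:R - ((N * R)%:R - D%:R) = D%:R :> C by ring.
rewrite mulrA divfK // divff ?scale1r //.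
Qed.

(** Choose isometries for [U] with real Gram blocks. The complement multiplies the off-diagonal
    blocks by a real number and has identity diagonal blocks, so its Gram matrix is real too. *)
Lemma is_real_naimark : naimark_complement R U V -> is_real U -> is_real V.
Proof.
move=> nUV /(real_isometries hU)[Phi iPhi rPhi].
have [Psi iPsi cross] := naimark_isometries nUV iPhi.
apply: (is_real_gram (TFF_naimark nUV) iPsi) => m n.
have [->|mn] := eqVneq m n.
  by rewrite (isometry_gram n iPsi) mxOver_scalar.
by rewrite cross 1?eq_sym // mxOverZ // rpredN gtr0_real.
Qed.

End Pair.

Lemma naimark_exists D R (U : subspaces C N D) :
    is_TFF R U -> D <> (N * R)%N ->
  exists V : subspaces C N (N * R - D), naimark_complement R U V.
Proof.
move=> hU DNR; have ltD := naimark_ltn hU DNR.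
have [[D_gt0 N_gt1 R_gt0] _ _] := hU.
have [Phi iPhi] := isometries_exist hU; have XA := TFF_stack hU iPhi.
set A : C := _ / _ in XA; set X := stack Phi in XA.
have A_gt1 : 1 < A by rewrite ltr_pdivlMr ?ltr0n // mul1r ltr_nat.
have A_gt0 : 0 < A by apply: lt_trans A_gt1.
have A_neq0 : A != 0 by rewrite gt_eqF.
have rA : A^-1 \is Num.real by rewrite gtr0_real // invr_gt0.
pose E := 1%:M - A^-1 *: (X *m X^t*).
have iXX : A^-1 *: (X *m X^t*) *m (A^-1 *: (X *m X^t*)) = A^-1 *: (X *m X^t*).
  rewrite -scalemxAl -scalemxAr mulmxA -[X *m _ *m X]mulmxA XA mul_mx_scalar.
  by rewrite -scalemxAl [A^-1 *: (A *: _)]scalerA mulVf // scale1r.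
have [||r [B [uB BB _]]] := @hermitian_idempotent_factor _ _ E.
- by rewrite adjB adjZ adjM trmxCK (CrealP rA) adj_scalar rmorph1.
- by rewrite mulmxBl mul1mx mulmxBr mulmx1 iXX subrr subr0.
have er : (N * R - D)%N = r.
  apply/eqP; rewrite -(eqr_nat C) -(mxtrace1 C r) -(unitarymxP uB).
  rewrite mxtrace_mulC BB raddfB /= mxtrace1 mxtraceZ mxtrace_mulC XA mxtrace_scalar.
  by rewrite mulrnAr mulVf // sum_nat_const card_ord natrB // ltnW.
(* Each diagonal block of [E] is [1 - A^-1] times the identity; scaling the rows of [B^t*] by [s],
   the square root of [c], turns the blocks into isometries. *)
rewrite er; pose c := (1 - A^-1)^-1.
have c_gt0 : 0 < c by rewrite invr_gt0 subr_gt0 invf_lt1.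
pose s := sqrtC c; have s_real : s \is Num.real by rewrite gtr0_real ?sqrtC_gt0.
have ss : s * s = c by rewrite -expr2 sqrtCK.
pose Psi n : 'M[C]_(R, r) := s *: submxcol (p_ := fun=> R) (B^t*) n.
have YE : stack Psi = s *: B^t*.
  apply/mxcolP => n; rewrite mxcolK; apply/matrixP => i j; by rewrite !mxE.
have D0 : D%:R != 0 :> C by rewrite pnatr_eq0 -lt0n.
have NR0 : (N * R)%:R != 0 :> C by rewrite pnatr_eq0 -lt0n muln_gt0 R_gt0 ltnW.
have NRD0 : (N * R)%:R - D%:R != 0 :> C.
  by rewrite -natrB 1?ltnW // pnatr_eq0 -lt0n subn_gt0.
have eA : A^-1 = D%:R / (N * R)%:R by rewrite invf_div.
have ec : c = 1 + naimark_ratio D R.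
  rewrite /c eA /naimark_ratio; move: NR0 NRD0; move: (_ %:R) (_ %:R) => x y x0 xy0.
  by field; rewrite x0 xy0.
have ecA : c * A^-1 = naimark_ratio D R.
  rewrite ec eA /naimark_ratio; move: NR0 NRD0; move: (_ %:R) (_ %:R) => x y x0 xy0.
  by field; rewrite x0 xy0.
have /stack_gramP cross : stack Psi *m (stack Psi)^t* =
    c%:M - naimark_ratio D R *: (stack Phi *m (stack Phi)^t*).
  rewrite YE adjZ trmxCK (CrealP s_real) -scalemxAl -scalemxAr scalerA ss BB.
  by rewrite scalerBr scalerA ecA scale_scalar_mx mulr1.
have uPsi n : Psi n \is unitarymx.
  apply/unitarymxP; rewrite cross eqxx mul1r (isometry_gram n iPhi).
  by rewrite scale_scalar_mx mulr1 -raddfB ec addrK.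
exists (fun n => <<Psi n>>%MS), Phi, Psi; split=> // [n|n1 n2 n12].
  by split=> //; apply/eqmxP/eqmx_sym/genmxE.
by rewrite cross eq_sym (negPf n12) mul0r raddf0 sub0r scaleNr.
Qed.

(** The trace of [P1 P2] is the squared Frobenius norm of a cross Gram block, and the complement
    multiplies that block by [- k]. *)
Lemma equichordal_naimark D D' R (U : subspaces C N D) (V : subspaces C N D') :
  naimark_complement R U V -> equichordal U -> equichordal V.
Proof.
case=> Phi [Psi [iPhi iPsi cross]] [c hc]; pose k := naimark_ratio D R.
exists (- k * (- k)^* * c) => n1 n2 n12.
have tr D1 (X : 'I_N -> 'M[C]_(R, D1)) (W : subspaces C N D1) : isometries_onto X W ->
    \tr (proj_ortho (W n1) *m proj_ortho (W n2)) =
    \tr (X n2 *m (X n1)^t* *m (X n2 *m (X n1)^t*)^t*).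
  move=> iX; rewrite !(isometry_proj _ iX) adjM trmxCK mulmxA mxtrace_mulC.
  by rewrite -[X in \tr X = _]mulmxA [LHS]mxtrace_mulC !mulmxA.
rewrite (tr _ _ _ iPsi) cross // -(hc n1 n2) // (tr _ _ _ iPhi).
by rewrite adjZ -scalemxAl -scalemxAr scalerA mxtraceZ.
Qed.

(** Compressing by the isometry of [n1] turns the condition into [G G^* = l] for the cross Gram
    block [G], a form that survives rescaling of [G]. *)
Lemma equi_isoclinic_naimark D D' R (U : subspaces C N D) (V : subspaces C N D') :
  naimark_complement R U V -> equi_isoclinic U -> equi_isoclinic V.
Proof.
case=> Phi [Psi [iPhi iPsi cross]] [l l0 hl]; pose k := naimark_ratio D R.
exists (- k * (- k)^* * l) => [|n1 n2 n12]; first by rewrite mulr_ge0 // mul_conjC_ge0.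
have gramP : Phi n1 *m (Phi n2)^t* *m (Phi n2 *m (Phi n1)^t*) = l%:M.
  have := hl _ _ n12; rewrite !(isometry_proj _ iPhi).
  move/(congr1 (fun M => Phi n1 *m M *m (Phi n1)^t*)).
  have g1 := isometry_gram n1 iPhi.
  rewrite !mulmxA g1 mul1mx -!mulmxA g1 mulmx1 => ->.
  by rewrite -scalemxAl -scalemxAr -mulmxA g1 mulmx1 g1 scalemx1.
rewrite !(isometry_proj _ iPsi).
have -> : (Psi n1)^t* *m Psi n1 *m ((Psi n2)^t* *m Psi n2) *m ((Psi n1)^t* *m Psi n1)
   = (Psi n1)^t* *m ((Psi n2 *m (Psi n1)^t*)^t* *m (Psi n2 *m (Psi n1)^t*)) *m Psi n1.
  by rewrite adjM trmxCK !mulmxA.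
rewrite cross // adjZ adjM trmxCK -!(scalemxAl, scalemxAr) scalerA gramP.
by rewrite mul_mx_scalar -scalemxAl scalerA [(- k)^* * _]mulrC.
Qed.

End NaimarkComplements.
(** * The action of complements on the parameters *)

Section ComplementParameters.
Variable N : nat.

Lemma fTFF_spatial D R : (R <= D)%N -> fTFF D N (D - R) = fTFF D N R.
Proof. by move=> RD; rewrite /fTFF -subzn //; ring. Qed.

Lemma fTFF_naimark D R : (D <= N * R)%N -> fTFF (N * R - D) N R = fTFF D N R.
Proof. by move=> DNR; rewrite /fTFF -subzn // PoszM; ring. Qed.

(** This predicate and [fundamental] are the families (i) and (ii) with denominators cleared, so
    that [lia] applies. *)
Definition degenerate D R := D = (N * R)%N \/ R = D.

Definition fundamental D R := [/\ (0 < R)%N, (2 * R <= D)%N & (2 * D <= N * R)%N].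

Lemma params_iP D R : (0 < N)%N -> params_i D N R <-> degenerate D R.
Proof.
move=> N_gt0; have N0 : (N%:R : rat) != 0 by rewrite pnatr_eq0 -lt0n.
rewrite /params_i /degenerate; split=> -[h|]; try by right.
  left; apply/eqP; rewrite -(eqr_nat rat) natrM h mulrC divfK //.
by left; rewrite h natrM mulrC mulKf.
Qed.

Lemma params_iiP D R : (0 < R)%N -> (0 < N)%N ->
  params_ii D N R <-> fundamental D R.
Proof.
move=> R_gt0 N_gt0; have N0 : 0 < (N%:R : rat) by rewrite ltr0n.
rewrite /params_ii /fundamental ler_pdivrMr // -(ler_nat rat (2 * R)) -(ler_nat rat (2 * D)) !natrM.
split=> -[h1 h2 h3]; first by split=> //; lra.
by split; [rewrite divr_gt0 //; move: R_gt0; rewrite -(ltr_nat rat)| |]; lra.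
Qed.

(** Chain [4 * R <= 2 * D <= N * R] and cancel [R]. *)
Lemma fundamental_N D R : fundamental D R -> (4 <= N)%N.
Proof. by case=> R0 RD DN; rewrite -(leq_pmul2r R0); lia. Qed.

Lemma fTFF_full D : fTFF D N D = - (D * D)%N%:Z.
Proof. by rewrite /fTFF PoszM; ring. Qed.

Lemma fTFF_orthogonal R : fTFF (N * R) N R = - (N * (R * R))%N%:Z.
Proof. by rewrite /fTFF !PoszM; ring. Qed.

Lemma fTFF_degenerate D R : (1 < N)%N -> (0 < R)%N -> degenerate D R ->
  fTFF D N R < 0.
Proof.
move=> N1 R0 [->|<-]; rewrite ?fTFF_orthogonal ?fTFF_full oppr_lt0 ltz_nat.
  by rewrite !muln_gt0 R0 ltnW.
by rewrite muln_gt0 R0.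
Qed.

(** With the slacks [d = D - 2R] and [e = NR - D - 2R], the form becomes [R d + R e + d e]. *)
Lemma fTFF_middle D R :
  (2 * R <= D)%N -> (D + 2 * R <= N * R)%N -> 0 <= fTFF D N R.
Proof.
move=> RD DN; have -> : fTFF D N R = D%:Z * (N * R)%N%:Z - D%:Z ^+ 2 - R%:Z * (N * R)%N%:Z.
  by rewrite /fTFF PoszM; ring.
have [d eD] : exists d, D = (2 * R + d)%N by exists (D - 2 * R)%N; lia.
have [e ->] : exists e, (N * R = D + 2 * R + e)%N by exists (N * R - (D + 2 * R))%N; lia.
rewrite eD [X in 0 <= X](_ : _ = (R * d + R * e + d * e)%N%:Z) //.
by rewrite !PoszD !PoszM; ring.
Qed.

Lemma fTFF_fundamental D R : fundamental D R -> 0 <= fTFF D N R.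
Proof. by case=> R0 RD DN; apply: fTFF_middle; lia. Qed.

(** The trace of [alternating] on pairs of dimensions. The strict inequalities keep the natural
    subtractions exact and the results positive. *)
Inductive parameter_path (D0 R0 : nat) : option complement_type -> nat -> nat -> Prop :=
| path_start : parameter_path D0 R0 None D0 R0
| path_spatial t D R : parameter_path D0 R0 t D R -> t <> Some Spatial ->
    (R < D)%N -> parameter_path D0 R0 (Some Spatial) D (D - R)
| path_naimark t D R : parameter_path D0 R0 t D R -> t <> Some Naimark ->
    (D < N * R)%N -> parameter_path D0 R0 (Some Naimark) (N * R - D) R.

Lemma path_inv D0 R0 t D R : parameter_path D0 R0 t D R ->
  match t with
  | None => D = D0 /\ R = R0
  | Some Spatial => exists t1 R1,
      [/\ parameter_path D0 R0 t1 D R1, t1 <> Some Spatial, (R1 < D)%N & R = (D - R1)%N]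
  | Some Naimark => exists t1 D1,
      [/\ parameter_path D0 R0 t1 D1 R, t1 <> Some Naimark, (D1 < N * R)%N
        & D = (N * R - D1)%N]
  end.
Proof. by case=> // [t1 D1 R1 *|t1 D1 R1 *]; [exists t1, R1|exists t1, D1]. Qed.

Lemma path_fTFF D0 R0 t D R : parameter_path D0 R0 t D R ->
  fTFF D N R = fTFF D0 N R0.
Proof.
elim=> // [t1 D1 R1 _ <- _ lt|t1 D1 R1 _ <- _ lt].
  by rewrite fTFF_spatial // ltnW.
by rewrite fTFF_naimark // ltnW.
Qed.

Lemma path_gcdn D0 R0 t D R : parameter_path D0 R0 t D R ->
  gcdn D R = gcdn D0 R0.
Proof.
elim=> // [t1 D1 R1 _ <- _ lt|t1 D1 R1 _ <- _ lt].
  have {1}-> : D1 = (D1 - R1 + R1)%N by rewrite subnK // ltnW.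
  rewrite gcdnC gcdnDl -[in RHS](subnK (ltnW lt)) gcdnC [RHS]gcdnC gcdnDr gcdnC //.
rewrite gcdnC [RHS]gcdnC; apply/eqP; rewrite eqn_dvd !dvdn_gcd !dvdn_gcdl /=.
have := ltnW lt; move/subnK=> e.
apply/andP; split.
  by rewrite -(dvdn_addr _ (dvdn_gcdr R1 (N * R1 - D1))) e dvdn_mull ?dvdn_gcdl.
by rewrite dvdn_sub ?dvdn_gcdr // dvdn_mull ?dvdn_gcdl.
Qed.

(** The invariants feed each other because [N >= 4]: [D <= 2R] implies [2D <= NR], so the next
    Naimark step gives at least half of [NR]; [NR <= 2D] implies [2R <= D], so the next spatial step
    gives at least half of [D]. *)
Lemma path_fundamental D0 R0 t D R : fundamental D0 R0 ->
    parameter_path D0 R0 t D R ->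
  (0 < R)%N /\ match t with
  | None => fundamental D R
  | Some Spatial => (D <= 2 * R)%N
  | Some Naimark => (N * R <= 2 * D)%N
  end.
Proof.
move=> f0; have N4 := fundamental_N f0.
elim=> [|[[]|] D1 R1 _ [R1_gt0 ih] nt lt|[[]|] D1 R1 _ [R1_gt0 ih] nt lt] //;
  try (by case: nt); try (case: ih => ? ? ?); first (by case: (f0));
  have NR : (4 * R1 <= N * R1)%N by rewrite leq_mul2r N4 orbT.
all: split; lia.
Qed.

Lemma path_to_fundamental D0 R0 t D R : fundamental D0 R0 ->
  parameter_path D0 R0 t D R -> fundamental D R -> D = D0 /\ R = R0.
Proof.
move=> f0; have N4 := fundamental_N f0.
elim=> [|t1 D1 R1 p1 ih nt lt f|t1 D1 R1 p1 ih nt lt f] //;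
  have [R1_gt0 inv] := path_fundamental f0 p1;
  have NR : (4 * R1 <= N * R1)%N by rewrite leq_mul2r N4 orbT.
  have e : (D1 - R1 = R1)%N.
    case: f => _ f _; case: t1 inv nt {p1 ih} => [[]|] // inv _; first lia.
    case: inv; lia.
  by rewrite e in f *; apply: ih.
have e : (N * R1 - D1 = D1)%N.
  case: f => _ _ f; case: t1 inv nt {p1 ih} => [[]|] // inv _; first lia.
  case: inv; lia.
by rewrite e in f *; apply: ih.
Qed.

(** Retrace both paths from their common end. Equal last types give equal previous pairs; otherwise
    the end is itself fundamental and both paths started there. *)
Lemma path_fundamental_unique D0 R0 t0 D1 R1 t1 D R :
    fundamental D0 R0 -> fundamental D1 R1 ->
    parameter_path D0 R0 t0 D R -> parameter_path D1 R1 t1 D R ->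
  D0 = D1 /\ R0 = R1.
Proof.
move=> f0 f1 p0; elim: p0 t1 => [|t D' R' p ih nt lt|t D' R' p ih nt lt] t1 q.
- exact: path_to_fundamental q f0.
- have p' := path_spatial p nt lt; have [Rg i0] := path_fundamental f0 p'.
  have both : fundamental D' (D' - R') -> D0 = D1 /\ R0 = R1.
    move=> f; have [<- <-] := path_to_fundamental f0 p' f.
    exact: path_to_fundamental f1 q f.
  have := path_inv q; have [_] := path_fundamental f1 q.
  case: t1 q => [[]|] q i1; last by move=> _; apply: both.
    case=> t2 [R2 [q2 _ lt2 e]]; have eR : R2 = R' by lia.
    by apply: ih; rewrite -eR; apply: q2.
  (* The last types differ, so both bounds hold at the end: [4R <= NR <= 2D <= 4R], and all are
     equalities. *)
  move=> _; apply: both; have N4 := fundamental_N f0.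
  have NR : (4 * (D' - R') <= N * (D' - R'))%N by rewrite leq_mul2r N4 orbT.
  by split; lia.
have p' := path_naimark p nt lt; have [Rg i0] := path_fundamental f0 p'.
have both : fundamental (N * R' - D') R' -> D0 = D1 /\ R0 = R1.
  move=> f; have [<- <-] := path_to_fundamental f0 p' f.
  exact: path_to_fundamental f1 q f.
have := path_inv q; have [_] := path_fundamental f1 q.
case: t1 q => [[]|] q i1; [|case=> t2 [D2 [q2 _ lt2 e]]|by move=> _; apply: both]; last first.
  have eD : D2 = D' by lia.
  by apply: ih; rewrite -eD; apply: q2.
move=> _; apply: both; have N4 := fundamental_N f0.
have NR : (4 * R' <= N * R')%N by rewrite leq_mul2r N4 orbT.
by split; lia.
Qed.

(** The range [2R <= D <= NR - 2R] is symmetric under [D -> NR - D], so a last Naimark step can be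
    undone inside it; a last spatial step ending in it has [D = 2R] and is trivial. *)
Lemma path_fundamental_middle D0 R0 t D R : fundamental D0 R0 ->
    parameter_path D0 R0 t D R -> (2 * R <= D)%N -> (D + 2 * R <= N * R)%N ->
  R = R0 /\ (D = D0 \/ D = (N * R0 - D0)%N).
Proof.
move=> f0; elim=> [|t1 D1 R1 p1 ih nt lt l1 l2|t1 D1 R1 p1 ih nt lt l1 l2].
- by split=> //; left.
- have [_ /= inv] := path_fundamental f0 (path_spatial p1 nt lt).
  have e : (D1 - R1 = R1)%N by lia.
  by rewrite e in l1 l2 *; apply: ih.
by have [||eR [eD|eD]] := ih; lia.
Qed.

(** * Paths out of degenerate pairs *)

Lemma gcdn_degenerate D R : degenerate D R -> gcdn D R = R.
Proof.
by case=> [->|<-]; [apply/gcdn_idPr; rewrite dvdn_mull|rewrite gcdnn].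
Qed.

(** The gcd recovers [R0]; then [fTFF] is [- N R0^2] or [- R0^2] in the two cases, which differ as
    [N > 1]. *)
Lemma path_degenerate_unique D0 R0 t0 D1 R1 t1 D R :
    (1 < N)%N -> (0 < R0)%N -> degenerate D0 R0 -> degenerate D1 R1 ->
    parameter_path D0 R0 t0 D R -> parameter_path D1 R1 t1 D R ->
  D0 = D1 /\ R0 = R1.
Proof.
move=> N1 R0_gt0 d0 d1 p0 p1.
have eR : R0 = R1.
  by rewrite -(gcdn_degenerate d0) -(path_gcdn p0) (path_gcdn p1) gcdn_degenerate.
rewrite -eR in d1 *; split=> //.
have := path_fTFF p0; rewrite (path_fTFF p1) -eR.
have lt : (R0 * R0 < N * (R0 * R0))%N by rewrite ltn_Pmull // muln_gt0 R0_gt0.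
case: d0 d1 => [->|<-] [->|<-] //; rewrite fTFF_orthogonal fTFF_full => e; lia.
Qed.

(** The alternatives for [D] are those that equi-isoclinism imposes on a frame and on its Naimark
    complement. A negative [fTFF] excludes the middle range, and in the remaining cases [R] divides
    [D], so [R] is the invariant gcd. *)
Lemma path_degenerate_middle D0 R0 t D R :
    (1 < N)%N -> (0 < R)%N -> degenerate D0 R0 -> parameter_path D0 R0 t D R ->
    D = R \/ (2 * R <= D)%N ->
    [\/ D = (N * R)%N, D + R = (N * R)%N | (D + 2 * R <= N * R)%N] ->
  R = R0 /\ (D = D0 \/ D%:Z = N%:Z * R0%:Z - D0%:Z).
Proof.
move=> N1 R_gt0 d0 p lo hi.
have eg := path_gcdn p; rewrite (gcdn_degenerate d0) in eg.
have R0_gt0 : (0 < R0)%N by rewrite -eg gcdn_gt0 R_gt0 orbT.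
have ef := path_fTFF p; have f_lt0 := fTFF_degenerate N1 R0_gt0 d0.
have dv : [\/ D = R, D = (N * R)%N | (D + R = N * R)%N].
  case: hi => [h|h|hi]; [by constructor 2|by constructor 3|].
  case: lo => [h|lo]; first by constructor 1.
  by have := fTFF_middle lo hi; rewrite ef leNgt f_lt0.
have eR : R = R0.
  rewrite -eg; symmetry; apply/gcdn_idPr.
  case: dv => [->//|->|e]; first by rewrite dvdn_mull.
  by rewrite -(dvdn_addl _ (dvdnn R)) e dvdn_mull.
split=> //; rewrite -eR in d0 ef *; move: ef; rewrite -PoszM.
have lt : (R * R < N * (R * R))%N by rewrite ltn_Pmull // muln_gt0 R_gt0.
(* The form is [- N R^2] for [D = NR] and [- R^2] for [D = R] or [D = NR - R], which decides the
   matching [D0]. *)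
case: dv => [->|->|eD]; case: d0 => [->|<-]; rewrite ?fTFF_orthogonal ?fTFF_full => e; try lia.
  all: have eD' : D = (N * R - R)%N by lia.
  all: have lt' : (R <= N * R)%N by lia.
  all: by move: e; rewrite eD' fTFF_naimark // fTFF_full; lia.
Qed.

End ComplementParameters.
(** * Equi-isoclinic subspaces *)

Section EquiIsoclinic.
Local Open Scope sesquilinear_scope.
Variables (C : numClosedFieldType) (N D R : nat) (U : subspaces C N D).
Hypothesis hU : is_TFF R U.

(* If [D < 2 * R], two of the subspaces share a nonzero vector, which forces
   [lambda = 1]; summing [P1 *m P2 *m P1 = P1] then gives [N * R / D = N]. *)
Lemma equi_isoclinic_rank : equi_isoclinic U -> D = R \/ (2 * R <= D)%N.
Proof.
move=> [l _ hl]; case: (leqP (2 * R) D) => [|ltD]; [by right|left].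
have [[D_gt0 N_gt1 R_gt0] rk _] := hU; have sumP := TFF_sum hU.
pose n1 := Ordinal (ltnW N_gt1); pose n2 := Ordinal N_gt1.
have n12 : n1 != n2 by [].
have cap0 : (U n1 :&: U n2 != 0)%MS.
  rewrite -mxrank_eq0 -lt0n; have := mxrank_sum_cap (U n1) (U n2).
  have := rank_leq_col (U n1 + U n2)%MS; rewrite !rk; lia.
have [i vi] : exists i, row i (U n1 :&: U n2)%MS != 0.
  apply/existsP; apply: contraNT cap0; rewrite negb_exists => /forallP h.
  by apply/eqP/row_matrixP => i; rewrite row0; apply/eqP; move: (h i); rewrite negbK.
have := row_sub i (U n1 :&: U n2)%MS; move: (row i _) vi => v v0.
rewrite sub_capmx => /andP[/proj_ortho_id v1 /proj_ortho_id v2].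
have l1 : l = 1.
  move: (hl _ _ n12) v1 v2; move: (proj_ortho _) (proj_ortho _) => P1 P2.
  move=> /(congr1 (mulmx v)) + v1 v2.
  rewrite !mulmxA v1 v2 v1 -scalemxAr v1 => /esym/eqP.
  rewrite -subr_eq0 -[X in _ - X]scale1r -scalerBl scaler_eq0 (negPf v0) orbF.
  by rewrite subr_eq0 => /eqP.
have PP n : proj_ortho (U n1) *m proj_ortho (U n) *m proj_ortho (U n1) = proj_ortho (U n1).
  have [->|nn] := eqVneq n n1; first by rewrite !proj_ortho_proj.
  by rewrite hl 1?eq_sym // l1 scale1r.
have : proj_ortho (U n1) *m (\sum_(n < N) proj_ortho (U n)) *m proj_ortho (U n1)
    = proj_ortho (U n1) *+ N.
  rewrite mulmx_sumr mulmx_suml (eq_bigr _ (fun n _ => PP n)).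
  by rewrite sumr_const card_ord.
rewrite sumP mul_mx_scalar -scalemxAl proj_ortho_proj -scaler_nat.
move/(congr1 mxtrace); rewrite !mxtraceZ mxtrace_proj_ortho rk.
have D0 : D%:R != 0 :> C by rewrite pnatr_eq0 -lt0n.
move/(congr1 (fun x => x * D%:R)); rewrite mulrAC divfK // -!natrM => /eqP.
by rewrite eqr_nat eqn_pmul2l ?muln_gt0 ?R_gt0 ?(ltnW N_gt1) // => /eqP.
Qed.

(** If [R = D], all projections are the identity. If [D = NR], they sum to the identity; compressing
    by [P1] and taking traces, the nonnegative terms with [n != n1] sum to zero, so [P1 P_n = 0]. *)
Lemma degenerate_equi_isoclinic : degenerate N D R -> equi_isoclinic U.
Proof.
have [[D_gt0 N_gt1 R_gt0] rk _] := hU; have sumP := TFF_sum hU.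
case=> [eD|eR]; last first.
  exists 1 => // n1 n2 _; suff P1 n : proj_ortho (U n) = 1%:M by rewrite !P1 !mulmx1 scale1r.
  by rewrite -[LHS]mul1mx proj_ortho_id // sub1mx /row_full rk eR.
have {}sumP : \sum_(n < N) proj_ortho (U n) = 1%:M.
  by rewrite sumP -eD divff // pnatr_eq0 -lt0n.
exists 0 => // n1 n2 n12; rewrite scale0r.
have PPE n : \tr (proj_ortho (U n1) *m proj_ortho (U n) *m proj_ortho (U n1)) =
    \tr (proj_ortho (U n1) *m proj_ortho (U n) *m
         (proj_ortho (U n1) *m proj_ortho (U n))^t*).
  rewrite adjM !proj_ortho_adj; have /= := proj_ortho_proj (U n).
  move: (proj_ortho (U n)) (proj_ortho (U n1)) => P P1 PP.
  by rewrite -!mulmxA [P *m (P *m _)]mulmxA PP.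
have /eqP := congr1 (fun M => \tr (proj_ortho (U n1) *m M *m proj_ortho (U n1))) sumP.
rewrite mulmx1 proj_ortho_proj mulmx_sumr mulmx_suml raddf_sum /= (bigD1 n1) //=.
rewrite !proj_ortho_proj -subr_eq0 [_ + _ - _]addrAC subrr add0r => /eqP.
under eq_bigr do rewrite PPE.
move=> /psumr_eq0P h; have {}h := h (fun n _ => mxtrace_mulmxtC_ge0 _) n2.
by rewrite (mxtrace_mulmxtC_eq0 (h _)) ?mul0mx // eq_sym.
Qed.

End EquiIsoclinic.

(** * Iterated alternating complements *)

Section Alternating.
Variables (C : numClosedFieldType) (N : nat).

(** The dimension bound is applied to the Naimark complement, again equi-isoclinic, in dimension
    [NR - D]. *)
Lemma equi_isoclinic_naimark_rank D R (U : subspaces C N D) :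
    is_TFF R U -> equi_isoclinic U ->
  [\/ D = (N * R)%N, (D + R = N * R)%N | (D + 2 * R <= N * R)%N].
Proof.
move=> hU eU; have [DNR|/eqP DNR] := eqVneq D (N * R)%N; first by constructor 1.
have [V UV] := naimark_exists hU DNR.
have hV := TFF_naimark hU DNR (erefl _) UV.
have ltD := naimark_ltn hU DNR.
have [e|le] := equi_isoclinic_rank hV (equi_isoclinic_naimark UV eU).
  by constructor 2; lia.
by constructor 3; lia.
Qed.

(** The equivalences need only one direction per complement, since a second complement of the same
    type leads back, up to unitary equivalence. *)
Lemma alternating_invariants D0 R0 (U0 : subspaces C N D0) t D R (V : subspaces C N D) :
    is_TFF R0 U0 -> alternating R0 U0 t R V ->
  [/\ is_TFF R V, parameter_path N D0 R0 t D R,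
      is_real U0 <-> is_real V & equichordal U0 <-> equichordal V].
Proof.
move=> h0; elim=> [|t1 D1 R1 U1 _ [hU p rU cU] nt DR
                   |t1 D1 D2 R1 U1 V1 _ [hU p rU cU] nt DNR eD nUV].
- by split=> //; constructor.
- have hV := TFF_spatial hU DR; have K := spatial_complementK U1.
  have [_ leR _] := TFF_bounds hU.
  split=> //; first by apply: path_spatial p nt _; move/eqP: DR; lia.
    rewrite rU; split=> [|/is_real_spatial]; first exact: is_real_spatial.
    exact: is_real_equivalent.
  rewrite cU; split=> [|/(equichordal_spatial hV)]; first exact: equichordal_spatial hU.
  exact: equichordal_equivalent.
have hV := TFF_naimark hU DNR eD nUV; have ltD := naimark_ltn hU DNR.
have nVU := naimark_sym hU DNR eD nUV.
have [D_gt0 _ _] : [/\ (0 < D1)%N, (1 < N)%N & (0 < R1)%N] by case: hU.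
have DNR' : D2 <> (N * R1)%N by lia.
have eD' : D1 = (N * R1 - D2)%N by lia.
split=> //; first by rewrite eD; apply: path_naimark p nt ltD.
  rewrite rU; split; first exact: (is_real_naimark hU DNR eD nUV).
  exact: (is_real_naimark hV DNR' eD' nVU).
rewrite cU; split; [exact: equichordal_naimark nUV|exact: equichordal_naimark nVU].
Qed.

(* The bounds on [t] make the next reducing step automatically of the other
   type. *)
Lemma alternating_reduction D R (U : subspaces C N D) : is_TFF R U ->
  exists D0 R0 (U0 : subspaces C N D0) t (V : subspaces C N D),
    [/\ is_TFF R0 U0, degenerate N D0 R0 \/ fundamental N D0 R0,
        alternating R0 U0 t R V, unitarily_equivalent V U
      & match t with
        | None => True
        | Some Spatial => (D < 2 * R)%N
        | Some Naimark => (N * R < 2 * D)%N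
        end].
Proof.
have [m] := ubnP (D + R); elim: m => // m IHm in D R U *; rewrite ltnS => leDR hU.
have [R_gt0 leRD leDNR] := TFF_bounds hU.
have [dDR|/eqP DR] := eqVneq D R.
  exists D, R, U, None, U; split=> //; [by left; right|by constructor|exact: equivalent_refl].
have [dDNR|/eqP DNR] := eqVneq D (N * R)%N.
  exists D, R, U, None, U; split=> //; [by left; left|by constructor|exact: equivalent_refl].
have [le1|lt1] := leqP (2 * R) D; last first.
  have [||D0 [R0 [U0 [t [V [h0 p0 alt VU ht]]]]]] := IHm _ (D - R)%N (spatial_complement U).
  - lia.
  - exact: TFF_spatial.
  exists D0, R0, U0, (Some Spatial), (spatial_complement V); split=> //.
    have := alternating_spatial alt; rewrite subKn //; apply; last by lia.
    by move=> et; rewrite et in ht; lia.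
  by apply: equivalent_trans (equivalent_spatial VU) _; exact: spatial_complementK.
have [le2|lt2] := leqP (2 * D) (N * R).
  exists D, R, U, None, U; split=> //; [by right|by constructor|exact: equivalent_refl].
have [W UW] := naimark_exists hU DNR.
have hW := TFF_naimark hU DNR (erefl _) UW.
have WU := naimark_sym hU DNR (erefl _) UW.
have [||D0 [R0 [U0 [t [V [h0 p0 alt VW ht]]]]]] := IHm _ R W; [lia|exact: hW|].
exists D0, R0, U0, (Some Naimark), U; split=> //; last exact: equivalent_refl.
have [D_gt0 _ _] : [/\ (0 < D)%N, (1 < N)%N & (0 < R)%N] by case: hU.
apply: (alternating_naimark alt).
- by move=> et; rewrite et in ht; lia.
- by lia.
- by rewrite subKn.
- exact: naimark_equivalent (equivalent_sym VW) WU.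
Qed.

Lemma obtained_from_invariants D0 R0 (U0 : subspaces C N D0) D R
    (U : subspaces C N D) :
    is_TFF R0 U0 -> obtained_from R0 R U0 U ->
  [/\ exists t, parameter_path N D0 R0 t D R,
      is_real U0 <-> is_real U & equichordal U0 <-> equichordal U].
Proof.
move=> h0 [t [V [alt VU]]]; have UV := equivalent_sym VU.
have [_ p rV cV] := alternating_invariants h0 alt; split; first by exists t.
  by rewrite rV; split; apply: is_real_equivalent.
by rewrite cV; split; apply: equichordal_equivalent.
Qed.

Lemma equi_isoclinic_parameters D0 R0 t D R (U : subspaces C N D) :
    is_TFF R U -> equi_isoclinic U ->
    degenerate N D0 R0 \/ fundamental N D0 R0 ->
    parameter_path N D0 R0 t D R ->
  R = R0 /\ (D = D0 \/ D%:Z = N%:Z * R0%:Z - D0%:Z).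
Proof.
move=> hU eU p0 p; have lo := equi_isoclinic_rank hU eU.
have hi := equi_isoclinic_naimark_rank hU eU.
have [[D_gt0 N_gt1 R_gt0] _ _] := hU.
case: p0 => [d0|f0]; first exact: (path_degenerate_middle N_gt1 R_gt0 d0 p lo hi).
have f_ge0 := fTFF_fundamental f0; rewrite -(path_fTFF p) in f_ge0.
(* Used for [(D, R)] and for its Naimark pair [(NR - D, R)], this rules out [D = R], [D = NR] and
   [D + R = NR]. *)
have ndeg D1 R1 : fTFF D1 N R1 = fTFF D N R -> (0 < R1)%N -> ~ degenerate N D1 R1.
  move=> ef R1_gt0 /(fTFF_degenerate N_gt1 R1_gt0).
  by rewrite ef ltNge f_ge0.
have {}lo : (2 * R <= D)%N.
  by case: lo => // e; case: (ndeg _ _ (erefl _) R_gt0); right.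
have {}hi : (D + 2 * R <= N * R)%N.
  case: hi => // e; first by case: (ndeg _ _ (erefl _) R_gt0); left.
  have le : (D <= N * R)%N by rewrite -e leq_addr.
  case: (ndeg _ _ (fTFF_naimark le) R_gt0); right.
  by rewrite -e addKn.
have [eR [eD|eD]] := path_fundamental_middle f0 p lo hi; split=> //; first by left.
by right; rewrite eD -PoszM subzn //; case: f0; lia.
Qed.

End Alternating.

(** * Sign dichotomy, uniqueness and transfer of properties *)

Theorem theorem3p6 (K : realType) (D N R : nat)
    (hD : (0 < D)%N) (hN : (1 < N)%N) (hR : (0 < R)%N)
    (U : subspaces K[i] N D) (hU : is_TFF R U) :
  [/\ (* existence, according to the sign of f(D,N,R) *)
      (fTFF D N R < 0 <->
         exists (D0 R0 : nat) (U0 : subspaces K[i] N D0),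
           [/\ is_TFF R0 U0, params_i D0 N R0 & obtained_from R0 R U0 U])
      /\
      (0 <= fTFF D N R <->
         exists (D0 R0 : nat) (U0 : subspaces K[i] N D0),
           [/\ is_TFF R0 U0, params_ii D0 N R0 & obtained_from R0 R U0 U]),
      (* families of type (i) are necessarily equi-isoclinic *)
      forall (D0 R0 : nat) (U0 : subspaces K[i] N D0),
        is_TFF R0 U0 -> params_i D0 N R0 -> equi_isoclinic U0,
      (* uniqueness of the triple (D0,N,R0) *)
      forall (D0 R0 D1 R1 : nat)
          (U0 : subspaces K[i] N D0) (U1 : subspaces K[i] N D1),
        is_TFF R0 U0 -> params_i D0 N R0 \/ params_ii D0 N R0 ->
        obtained_from R0 R U0 U ->
        is_TFF R1 U1 -> params_i D1 N R1 \/ params_ii D1 N R1 ->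
        obtained_from R1 R U1 U ->
        (D0, N, R0) = (D1, N, R1)
    & forall (D0 R0 : nat) (U0 : subspaces K[i] N D0),
        is_TFF R0 U0 -> params_i D0 N R0 \/ params_ii D0 N R0 ->
        obtained_from R0 R U0 U ->
        [/\ equi_isoclinic U ->
              R = R0 /\ (D = D0 \/ D%:Z = N%:Z * R0%:Z - D0%:Z),
            is_real U0 <-> is_real U
          & equichordal U0 <-> equichordal U]].
Proof.
have N_gt0 := ltnW hN.
have paramsP D0 R0 (U0 : subspaces K[i] N D0) : is_TFF R0 U0 ->
    (params_i D0 N R0 <-> degenerate N D0 R0) /\
    (params_ii D0 N R0 <-> fundamental N D0 R0).
  move=> h0; have [R0_gt0 _ _] := TFF_bounds h0.
  by split; [apply: params_iP|apply: params_iiP].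
have invP D0 R0 (U0 : subspaces K[i] N D0) : is_TFF R0 U0 ->
    params_i D0 N R0 \/ params_ii D0 N R0 ->
    degenerate N D0 R0 \/ fundamental N D0 R0.
  by move=> /paramsP[e1 e2] [/e1|/e2]; [left|right].
(* Invariance of [fTFF] makes each family force a sign; this gives the converse implications,
   selects the family reached by the reduction and excludes mixed cases in uniqueness. *)
have sign_i D0 R0 (U0 : subspaces K[i] N D0) : is_TFF R0 U0 ->
    degenerate N D0 R0 -> obtained_from R0 R U0 U -> fTFF D N R < 0.
  move=> h0 d0 /(obtained_from_invariants h0)[[t p] _ _].
  have [R0_gt0 _ _] := TFF_bounds h0.
  by rewrite (path_fTFF p) fTFF_degenerate.
have sign_ii D0 R0 (U0 : subspaces K[i] N D0) : is_TFF R0 U0 ->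
    fundamental N D0 R0 -> obtained_from R0 R U0 U -> 0 <= fTFF D N R.
  move=> h0 f0 /(obtained_from_invariants h0)[[t p] _ _].
  by rewrite (path_fTFF p) fTFF_fundamental.
have [D0 [R0 [U0 [t [V [h0 p0 alt VU _]]]]]] := alternating_reduction hU.
have obt : obtained_from R0 R U0 U by exists t, V.
have [e1 e2] := paramsP _ _ _ h0.
split.
- split; split.
  + move=> f_lt0; exists D0, R0, U0; split=> //; apply/e1.
    by case: p0 => // f0; move: f_lt0; rewrite ltNge (sign_ii _ _ _ h0 f0 obt).
  + by case=> D1 [R1 [U1 [h1 /(paramsP _ _ _ h1).1 d1]]]; apply: sign_i h1 d1.
  + move=> f_ge0; exists D0, R0, U0; split=> //; apply/e2.
    by case: p0 => // d0; move: f_ge0; rewrite leNgt (sign_i _ _ _ h0 d0 obt).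
  + by case=> D1 [R1 [U1 [h1 /(paramsP _ _ _ h1).2 f1]]]; apply: sign_ii h1 f1.
- by move=> D1 R1 U1 h1 /(paramsP _ _ _ h1).1; apply: degenerate_equi_isoclinic h1.
- move=> D1 R1 D2 R2 U1 U2 h1 /(invP _ _ _ h1) p1 o1 h2 /(invP _ _ _ h2) p2 o2.
  have [[t1 q1] _ _] := obtained_from_invariants h1 o1.
  have [[t2 q2] _ _] := obtained_from_invariants h2 o2.
  have [R1_gt0 _ _] := TFF_bounds h1.
  suff [-> ->] : D1 = D2 /\ R1 = R2 by [].
  case: p1 p2 => [d1|f1] [d2|f2].
  + exact: path_degenerate_unique q1 q2.
  + by have := sign_i _ _ _ h1 d1 o1; rewrite ltNge (sign_ii _ _ _ h2 f2 o2).
  + by have := sign_i _ _ _ h2 d2 o2; rewrite ltNge (sign_ii _ _ _ h1 f1 o1).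
  + exact: path_fundamental_unique f1 f2 q1 q2.
move=> D1 R1 U1 h1 /(invP _ _ _ h1) p1 o1.
have [[t1 q1] rU cU] := obtained_from_invariants h1 o1; split=> // eU.
exact: equi_isoclinic_parameters hU eU p1 q1.
Qed.
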